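(* Let $\mathcal{H}$ be a real Hilbert space, let $f\in\Gamma_0(\mathcal{H})$ with perspective $\widetilde{f}$, and let $(x,\eta,\delta)\in\mathcal{H}\times\mathbb{R}\times\mathbb{R}$. Then $$P_{\operatorname{epi}\widetilde{f}}(x,\eta,\delta)=\begin{cases}\big(P_{\overline{\operatorname{dom}}\,\widetilde{f}}(x,\eta),\delta\big),&\text{if }\widetilde{f}\big(P_{\overline{\operatorname{dom}}\,\widetilde{f}}(x,\eta)\big)\le\delta;\\[2mm]\big(\operatorname{prox}_{\mu\widetilde{f}}(x,\eta),\delta+\mu\big),&\text{if }\widetilde{f}\big(P_{\overline{\operatorname{dom}}\,\widetilde{f}}(x,\eta)\big)>\delta,\end{cases}$$ where, in the second case, $\mu\in\big]0,-\delta+\widetilde{f}\big(P_{\overline{\operatorname{dom}}\,\widetilde{f}}(x,\eta)\big)\big]\cap\mathbb{R}$ is the unique solution to $$\mu+\delta-\widetilde{f}\big(\operatorname{prox}_{\mu\widetilde{f}}(x,\eta)\big)=0.$$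
   Context: $\Gamma_0(\mathcal{H})$ is the class of proper lower semicontinuous convex functions from the real Hilbert space $\mathcal{H}$ to $]-\infty,+\infty]$; $\operatorname{dom} f=\{x\in\mathcal{H} : f(x)<+\infty\}$ and $\overline{\operatorname{dom}}\,f$ denotes its closure. The recession function of $f\in\Gamma_0(\mathcal{H})$ is $(\operatorname{rec} f)(x)=\lim_{t\to+\infty}\frac{f(x_0+tx)-f(x_0)}{t}$, for any $x_0\in\operatorname{dom} f$ (the value does not depend on $x_0$). The perspective of $f$ is $\widetilde{f}\colon\mathcal{H}\times\mathbb{R}\to\,]-\infty,+\infty]$, defined by $\widetilde{f}(x,\eta)=\eta f(x/\eta)$ if $\eta>0$, $\widetilde{f}(x,0)=(\operatorname{rec} f)(x)$, and $\widetilde{f}(x,\eta)=+\infty$ if $\eta<0$. It belongs to $\Gamma_0(\mathcal{H}\oplus\mathbb{R})$, where $\oplus$ is the Hilbert direct sum (so $\|(x,\eta)\|^2=\|x\|^2+\eta^2$). Its epigraph is $\operatorname{epi}\widetilde{f}=\{(x,\eta,\delta)\in\mathcal{H}\times\mathbb{R}\times\mathbb{R} : \widetilde{f}(x,\eta)\le\delta\}$, a closed convex cone in $\mathcal{H}\oplus\mathbb{R}\oplus\mathbb{R}$. For $g\in\Gamma_0(\mathcal{G})$ on a real Hilbert space $\mathcal{G}$, $\operatorname{prox}_g(z)$ is the unique minimizer of $y\mapsto g(y)+\frac12\|z-y\|^2$; $P_C$ denotes the projection onto a nonempty closed convex set $C$. *)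

(* Defs.v *)
From HB Require Import structures.
From mathcomp Require Import all_boot all_order all_algebra.
From mathcomp Require Import lra.
From mathcomp Require Import all_classical all_reals all_analysis.

Set Implicit Arguments.
Unset Strict Implicit.
Unset Printing Implicit Defensive.

Import Order.TTheory GRing.Theory Num.Theory.
Import numFieldNormedType.Exports.

Local Open Scope classical_set_scope.
Local Open Scope ring_scope.

HB.mixin Record CompleteNormedModule_isHilbert (R : realType) V
    & CompleteNormedModule R V := {
  inner : {dot V for idfun};
  innerE : forall x : V, inner x x = `|x| ^+ 2
}.

#[short(type="hilbertType")]
HB.structure Definition Hilbert (R : realType) :=
  {V of CompleteNormedModule R V & CompleteNormedModule_isHilbert R V}.

Section regular.
Variable R : realType.

Definition regular_inner (x y : R^o) : R := x * y.

Let regular_bilinear :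
  bilinear_for *%R (idfun \; *%R) (regular_inner : R^o -> R^o -> R).
Proof.
split=> [y a u v|x a u v]; rewrite /regular_inner /GRing.scale/=.
  by rewrite mulrDl mulrA.
by rewrite mulrDr mulrCA.
Qed.

HB.instance Definition _ := bilinear_isBilinear.Build R R^o R^o R *%R
  (idfun \; *%R) regular_inner regular_bilinear.

Let regular_hermitian (x y : R^o) :
  regular_inner x y = (-1) ^+ false * idfun (regular_inner y x).
Proof. by rewrite expr0 mul1r /regular_inner mulrC. Qed.

HB.instance Definition _ := isHermitianSesquilinear.Build R R^o false idfun
  regular_inner regular_hermitian.

Let regular_dot (x : R^o) : x != 0 -> 0 < regular_inner x x.
Proof. by move=> x0; rewrite [ltRHS]/regular_inner lt0r mulf_neq0//= -[leRHS]expr2 sqr_ge0. Qed.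

HB.instance Definition _ := isDotProduct.Build R R^o regular_inner regular_dot.

Let regular_innerE (x : R^o) : regular_inner x x = `|x| ^+ 2.
Proof. by rewrite real_normK ?num_real. Qed.

HB.instance Definition _ :=
  CompleteNormedModule_isHilbert.Build R R^o regular_innerE.

End regular.

(* The product type [U * V] already carries the sup norm in the library; the
   Hilbert direct sum is therefore put on an alias of it. *)
Definition hsum (R : realType) (U V : hilbertType R) : Type := (U * V)%type.

Section hsum.
Variables (R : realType) (U V : hilbertType R).
Local Notation W := (hsum U V).

HB.instance Definition _ := GRing.Lmodule.copy W (U * V)%type.

Definition hsum_norm (z : W) : R := Num.sqrt (`|z.1| ^+ 2 + `|z.2| ^+ 2).

Let le_hsum_normD (x y : W) : hsum_norm (x + y) <= hsum_norm x + hsum_norm y.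
Proof.
rewrite /hsum_norm /=.
have := ler_normD x.1 y.1; have := ler_normD x.2 y.2.
have := normr_ge0 (x.1 + y.1); have := normr_ge0 (x.2 + y.2).
have := normr_ge0 x.1; have := normr_ge0 y.1.
have := normr_ge0 x.2; have := normr_ge0 y.2.
move: (`|_ + _|) (`|x.1 + _|) (`|x.1|) (`|x.2|) (`|y.1|) (`|y.2|).
move=> f e a b c d d0 b0 c0 a0 f0 e0 fle ele.
set s := Num.sqrt (a ^+ 2 + _); set t := Num.sqrt (c ^+ 2 + _).
have s0 : 0 <= s by exact: sqrtr_ge0.
have t0 : 0 <= t by exact: sqrtr_ge0.
have sE : s ^+ 2 = a ^+ 2 + b ^+ 2 by rewrite sqr_sqrtr// addr_ge0// sqr_ge0.
have tE : t ^+ 2 = c ^+ 2 + d ^+ 2 by rewrite sqr_sqrtr// addr_ge0// sqr_ge0.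
have st : a * c + b * d <= s * t.
  rewrite -(@ler_pXn2r _ 2)// ?nnegrE ?addr_ge0 ?mulr_ge0//.
  rewrite exprMn sE tE.
  by have := sqr_ge0 (a * d - b * c); nra.
rewrite -(@ger0_norm _ (s + t)) ?addr_ge0// -sqrtr_sqr ler_wsqrtr//.
have ee : e ^+ 2 <= (a + c) ^+ 2 by rewrite ler_pXn2r// nnegrE ?addr_ge0.
have ff : f ^+ 2 <= (b + d) ^+ 2 by rewrite ler_pXn2r// nnegrE ?addr_ge0.
by rewrite (le_trans (lerD ee ff))// !sqrrD sE tE; lra.
Qed.

Let hsum_normZ (a : R) (x : W) : hsum_norm (a *: x) = `|a| * hsum_norm x.
Proof.
rewrite /hsum_norm /= !normrZ !exprMn -mulrDr sqrtrM ?sqr_ge0//.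
by rewrite sqrtr_sqr normr_id.
Qed.

Let hsum_norm0 (x : W) : hsum_norm x = 0 -> x = 0.
Proof.
move=> /eqP; rewrite sqrtr_eq0 => h.
have h1 := sqr_ge0 `|x.1|; have h2 := sqr_ge0 `|x.2|.
have /eqP e1 : `|x.1| ^+ 2 == 0 by rewrite eq_le h1 andbT; lra.
have /eqP e2 : `|x.2| ^+ 2 == 0 by rewrite eq_le h2 andbT; lra.
move: e1 e2 => /eqP; rewrite sqrf_eq0 normr_eq0 => /eqP x1 /eqP.
rewrite sqrf_eq0 normr_eq0 => /eqP x2.
by case: x x1 x2 {h h1 h2} => /= ? ? -> ->.
Qed.

HB.instance Definition _ :=
  Lmodule_isNormed.Build R W le_hsum_normD hsum_normZ hsum_norm0.

Lemma hsum_normE (z : W) : `|z| = Num.sqrt (`|z.1| ^+ 2 + `|z.2| ^+ 2).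
Proof. by []. Qed.

Let fst_le (z : W) : `|z.1| <= `|z|.
Proof.
rewrite hsum_normE -[leLHS]normr_id -sqrtr_sqr ler_wsqrtr//.
by rewrite lerDl sqr_ge0.
Qed.

Let snd_le (z : W) : `|z.2| <= `|z|.
Proof.
rewrite hsum_normE -[leLHS]normr_id -sqrtr_sqr ler_wsqrtr//.
by rewrite lerDr sqr_ge0.
Qed.

Let norm_le (z : W) : `|z| <= `|z.1| + `|z.2|.
Proof.
rewrite hsum_normE -[leRHS]ger0_norm ?addr_ge0// -sqrtr_sqr ler_wsqrtr//.
by rewrite sqrrD -addrA lerD2l lerDr mulrn_wge0// mulr_ge0.
Qed.

Let hsum_complete (F : set_system W) : ProperFilter F -> cauchy F -> cvg F.
Proof.
move=> FF /cauchy_ballP Fc.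
have c1 : cauchy ((fun z : W => z.1) @ F).
  apply/cauchy_ballP => e e0.
  have := Fc e e0; rewrite -!ball_normE /= => -[[A B] [FA FB] AB].
  exists ((fun z : W => z.1) @` A, (fun z : W => z.1) @` B).
    by split; [apply: filterS FA|apply: filterS FB] => z /= Az; exists z.
  move=> [? ?] [/= [a Aa <-] [b Bb <-]].
  by apply: le_lt_trans (fst_le (a - b)) _; exact: (AB (a, b)).
have c2 : cauchy ((fun z : W => z.2) @ F).
  apply/cauchy_ballP => e e0.
  have := Fc e e0; rewrite -!ball_normE /= => -[[A B] [FA FB] AB].
  exists ((fun z : W => z.2) @` A, (fun z : W => z.2) @` B).
    by split; [apply: filterS FA|apply: filterS FB] => z /= Az; exists z.
  move=> [? ?] [/= [a Aa <-] [b Bb <-]].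
  by apply: le_lt_trans (snd_le (a - b)) _; exact: (AB (a, b)).
have /cvg_ex[u Fu] : cvg ((fun z : W => z.1) @ F) by exact: cauchy_cvg.
have /cvg_ex[v Fv] : cvg ((fun z : W => z.2) @ F) by exact: cauchy_cvg.
apply/cvg_ex; exists ((u, v) : W).
apply/cvgrPdist_lt => e e0.
have e20 : 0 < e / 2 by rewrite divr_gt0.
have n1 : \forall z \near F, `|u - z.1| < e / 2.
  by move/cvgrPdist_lt : Fu => /(_ _ e20).
have n2 : \forall z \near F, `|v - z.2| < e / 2.
  by move/cvgrPdist_lt : Fv => /(_ _ e20).
apply: filterS2 n1 n2 => z z1 z2.
by rewrite (le_lt_trans (norm_le _))// [ltRHS]splitr ltrD.
Qed.

HB.instance Definition _ := Uniform_isComplete.Build W hsum_complete.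

Definition hsum_inner (x y : W) : R := inner x.1 y.1 + inner x.2 y.2.

Let hsum_bilinear : bilinear_for *%R (idfun \; *%R) hsum_inner.
Proof.
split=> [y a u v|x a u v]; rewrite /hsum_inner /=.
  by rewrite !linearPl/= mulrDr addrACA.
by rewrite !linearPr/= mulrDr addrACA.
Qed.

HB.instance Definition _ := bilinear_isBilinear.Build R W W R *%R
  (idfun \; *%R) hsum_inner hsum_bilinear.

Let hsum_hermitian (x y : W) :
  hsum_inner x y = (-1) ^+ false * idfun (hsum_inner y x).
Proof.
by rewrite /hsum_inner hermC [in X in _ + X]hermC !expr0 !mul1r.
Qed.

HB.instance Definition _ := isHermitianSesquilinear.Build R W false idfun
  hsum_inner hsum_hermitian.

Let hsum_innerE (x : W) : hsum_inner x x = `|x| ^+ 2.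
Proof.
by rewrite /hsum_inner !innerE hsum_normE sqr_sqrtr// addr_ge0// sqr_ge0.
Qed.

Let hsum_dot (x : W) : x != 0 -> 0 < hsum_inner x x.
Proof. by move=> x0; rewrite hsum_innerE exprn_gt0// normr_gt0. Qed.

HB.instance Definition _ := isDotProduct.Build R W hsum_inner hsum_dot.

HB.instance Definition _ :=
  CompleteNormedModule_isHilbert.Build R W hsum_innerE.

End hsum.

Section convex_analysis.
Variables (R : realType) (G : hilbertType R).
Implicit Types (f g : G -> \bar R) (C : set G) (x y z p : G).
Local Open Scope ereal_scope.

Definition dom f : set G := [set x | f x < +oo].

Definition epi f : set (hsum G R^o) := [set z | f z.1 <= (z.2)%:E].

Definition proper_efun f := (forall x, f x != -oo) /\ dom f !=set0.

Definition convex_efun f := forall x y (t : R), (0 < t < 1)%R ->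
  f (t *: x + (1 - t) *: y)%R <= t%:E * f x + (1 - t)%:E * f y.

Definition Gamma0 f := [/\ proper_efun f, lower_semicontinuous f & convex_efun f].

(* For f in Gamma0 the limit does not depend on the point of [dom f]; [xget]
   selects one, with an irrelevant default value when [dom f] is empty. *)
Definition recession f x : \bar R :=
  let x0 := xget 0%R (dom f) in
  lim ((t^-1)%:E * (f (x0 + t *: x)%R - f x0) @[t --> +oo%R]).

Definition perspective f (z : hsum G R^o) : \bar R :=
  if (0 < z.2)%R then (z.2 : R)%:E * f (z.2^-1 *: z.1)%R
  else if z.2 == 0%R then recession f z.1
  else +oo.

(* The default value of [xget] is only reached when there is no minimizer,
   which does not happen for g in Gamma0, nor for C nonempty closed convex;
   in these cases the minimizer is unique. *)
Definition prox g z : G := xget 0%R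
  [set p | forall y, g p + (2^-1 * `|z - p| ^+ 2)%:E
                     <= g y + (2^-1 * `|z - y| ^+ 2)%:E].

Definition metric_proj C z : G := xget 0%R
  [set p | C p /\ forall y, C y -> (`|z - p| <= `|z - y|)%R].

End convex_analysis.

(* Main.v *)
(* For any g in Gamma0(G), the variational inequality of the projection (p, r)
   of (z, d) onto epi g, tested at the points (y, g y), reads
   <z - p, y - p> <= (r - d) (g y - r) with r >= d.  If r = d, then p is the
   projection of z onto the closed domain; otherwise r = g p, and dividing by
   r - d shows that p = prox_{(r - d) g} z.  Conversely, a solution m of the
   scalar equation makes (prox_{m g} z, d + m) satisfy that variational
   inequality, whence uniqueness.

   It remains to see that the perspective of f is in Gamma0.  The same
   projections onto epigraphs show that f is the supremum of its continuous
   affine minorants <u, .> - c; its perspective is then the supremum of the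
   linear functions (x, eta) |-> <u, x> - c eta, which is convex and lower
   semicontinuous. *)
Require Import Defs.
From mathcomp Require Import all_boot all_order all_algebra.
From mathcomp Require Import lra.
From mathcomp Require Import all_classical all_reals all_analysis.
Import Order.TTheory GRing.Theory Num.Theory.
Import numFieldNormedType.Exports.
Local Open Scope classical_set_scope.
Local Open Scope ring_scope.

(** * Inner product calculus and the Cauchy-Schwarz inequality *)

Section inner_theory.
Context {R : realType} {G : hilbertType R}.
Implicit Types (a t : R) (x y z : G).

Lemma innerC x y : inner x y = inner y x.
Proof. by rewrite hermC expr0 mul1r. Qed.

Lemma innerDl x y z : inner (x + y) z = inner x z + inner y z.
Proof. exact: linearDl. Qed.

Lemma innerDr x y z : inner z (x + y) = inner z x + inner z y.
Proof. by rewrite !(innerC z) innerDl. Qed.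

Lemma innerZl a x z : inner (a *: x) z = a * inner x z.
Proof. by rewrite linearZl_LR. Qed.

Lemma innerZr a x z : inner z (a *: x) = a * inner z x.
Proof. by rewrite !(innerC z) innerZl. Qed.

Lemma innerNl x z : inner (- x) z = - inner x z.
Proof. exact: linearNl. Qed.

Lemma innerNr x z : inner z (- x) = - inner z x.
Proof. by rewrite !(innerC z) innerNl. Qed.

Definition inner_lin := (innerDl, innerDr, innerZl, innerZr, innerNl, innerNr).

Lemma sqr_normD x y : `|x + y| ^+ 2 = `|x| ^+ 2 + 2 * inner x y + `|y| ^+ 2.
Proof. by rewrite -!innerE !inner_lin (innerC y x); lra. Qed.

(** Cauchy-Schwarz: the squared norm of |y| x - |x| y is nonnegative; expand it and divide by |x|
    |y|. *)
Lemma inner_le_norm x y : inner x y <= `|x| * `|y|.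
Proof.
have [->|x0] := eqVneq x 0; first by rewrite -(scale0r 0) innerZl !normrZ normr0 !mul0r.
have [->|y0] := eqVneq y 0; first by rewrite -(scale0r 0) innerZr !normrZ normr0 !mul0r mulr0.
have p : 0 < `|x| * `|y| by rewrite mulr_gt0// normr_gt0.
have := sqr_ge0 `| `|y| *: x - `|x| *: y |.
rewrite sqr_normD normrN !normrZ !normr_id innerNr innerZl innerZr => h.
by rewrite -(ler_pM2l p); nra.
Qed.

End inner_theory.

(** * Minimizers and their variational inequalities *)

Section prox_theory.
Context {R : realType} {G : hilbertType R}.
Implicit Types (g : G -> \bar R) (C : set G) (a b t : R) (x y z p : G).

Lemma lsc_ball g x a : lower_semicontinuous g -> (a%:E < g x)%E ->
  exists2 e : R, 0 < e & forall y, `|x - y| < e -> (a%:E < g y)%E.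
Proof.
move=> lsc /lsc[V /nbhs_ballP[e /= e0 xV] Vg]; exists e => // y xy.
by apply/Vg/xV; rewrite -ball_normE.
Qed.

(** Divide by [t] and let [t] tend to 0; this extracts first-order conditions from minimality. *)
Lemma le0_of_quadratic (c D : R) : 0 <= D ->
  (forall t : R, 0 < t < 1 -> t * c <= t ^+ 2 * D) -> c <= 0.
Proof.
move=> D0 h; rewrite leNgt; apply/negP => c0.
have d0 : 0 < 2 * c + D by lra.
(* This [t] satisfies t D = c - 2 t c < c, against c <= t D. *)
have t0 : 0 < c / (2 * c + D) by rewrite divr_gt0.
have t1 : c / (2 * c + D) < 1 by rewrite ltr_pdivrMr//; lra.
set t := c / _ in t0 t1.
have tE : t * (2 * c + D) = c by rewrite divfK// gt_eqF.
have := h t; rewrite t0 t1 => /(_ isT).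
rewrite expr2 -(mulrA t t D) ler_pM2l// => ctD.
by have := mulr_gt0 t0 c0; lra.
Qed.

Definition is_prox g z p := forall y,
  (g p + (2^-1 * `|z - p| ^+ 2)%:E <= g y + (2^-1 * `|z - y| ^+ 2)%:E)%E.

Lemma sqr_dist z p y : `|z - y| ^+ 2 =
  `|z - p| ^+ 2 - 2 * inner (z - p) (y - p) + `|y - p| ^+ 2.
Proof.
have -> : z - y = (z - p) + - (y - p) by rewrite opprB addrA subrK.
by rewrite sqr_normD normrN innerNr; lra.
Qed.

(** The direct method: by strong convexity of the quadratic term a minimizing sequence is Cauchy,
    and lower semicontinuity makes its limit a minimizer. *)
Lemma prox_exists g z b : lower_semicontinuous g -> convex_efun g ->
  dom g !=set0 -> (forall y, b%:E <= g y + (2^-1 * `|z - y| ^+ 2)%:E)%E ->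
  exists p, is_prox g z p.
Proof.
move=> lsc cvx [y0 y0dom] lb.
pose phi y := (g y + (2^-1 * `|z - y| ^+ 2)%:E)%E.
pose E := [set r : R | exists y, (phi y <= r%:E)%E].
have gNy y : g y != -oo%E.
  by apply/eqP => gy; have := lb y; rewrite gy leeNy_eq.
have bE r : E r -> b <= r.
  by move=> [y yr]; rewrite -lee_fin; exact: le_trans (lb y) yr.
have Einf : has_inf E.
  split; last by exists b => r /bE.
  move: y0dom (gNy y0); rewrite /dom /=; case gy0 : (g y0) => [c| |] // _ _.
  by exists (c + 2^-1 * `|z - y0| ^+ 2), y0; rewrite /phi gy0.
pose m := inf E.
have mle y : (m%:E <= phi y)%E.
  have := gNy y; rewrite /phi; case gy : (g y) => [c| |] // _; last by rewrite addye// leey.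
  rewrite -EFinD lee_fin; apply: ge_inf; first exact: Einf.2.
  by exists y; rewrite /phi gy.
have near_min (e : R) : 0 < e -> exists y, (phi y <= (m + e)%:E)%E.
  move=> e0; have [r [y yr] rm] := inf_adherent e0 Einf.
  by exists y; apply: le_trans yr _; rewrite lee_fin ltW.
have /choice[u uP] (n : nat) : exists y, (phi y <= (m + n.+1%:R^-1)%:E)%E.
  by apply: near_min; rewrite invr_gt0.
(* Near-minimizers are close: [phi] is at least [m] at the midpoint, and the parallelogram identity
   leaves |x - y|^2 / 8 <= (a + c) / 2. *)
have close x y a c : (phi x <= (m + a)%:E)%E -> (phi y <= (m + c)%:E)%E ->
    `|x - y| ^+ 2 <= 4 * (a + c).
  have h : (0 < 2^-1 :> R) && (2^-1 < 1 :> R) by apply/andP; split; lra.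
  have := gNy x; have := gNy y; rewrite /phi.
  case gx : (g x) => [r| |]; case gy : (g y) => [s| |] // _ _.
  rewrite -!EFinD !lee_fin => xa yc.
  have := cvx x y _ h; rewrite gx gy -!EFinM -EFinD => mid.
  have := le_trans (mle _) (leeD mid (le_refl _)).
  rewrite -EFinD lee_fin => {gx gy}.
  have -> : z - (2^-1 *: x + (1 - 2^-1) *: y) = 2^-1 *: (z - x) + 2^-1 *: (z - y).
    rewrite -scalerDr addrACA scalerDr -mulr2n -[z *+ 2]scaler_nat scalerA mulVf// scale1r.
    rewrite (_ : 1 - 2^-1 = 2^-1 :> R); last by lra.
    by rewrite -scalerDr -opprD scalerN.
  have -> : x - y = (z - y) + - (z - x) by rewrite opprB [RHS]addrC addrA subrK.
  move: (z - x) (z - y) xa yc => A B xa yc.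
  rewrite !sqr_normD normrN innerNr innerZl innerZr !normrZ ger0_norm// (innerC B).
  rewrite !exprMn; lra.
have : cvg (u @ \oo).
  apply: cauchy_cvg; apply: cauchy_exP => e e0.
  (* Two slacks below e^2 / 8 bring the bound 4 (a + c) below e^2. *)
  have e8 : 0 < e ^+ 2 / 8 by rewrite divr_gt0// exprn_gt0.
  have [N _ NP] := near_infty_natSinv_lt (PosNum e8).
  exists (u N); exists N => // n /= Nn.
  rewrite -ball_normE /= -(@ltr_pXn2r _ 2)// ?nnegrE ?(ltW e0)//.
  apply: le_lt_trans (close _ _ _ _ (uP N) (uP n)) _.
  have hN : N.+1%:R^-1 < e ^+ 2 / 8 := NP N (leqnn N).
  have hn : n.+1%:R^-1 < e ^+ 2 / 8 := NP n Nn.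
  move: (N.+1%:R^-1) (n.+1%:R^-1) (e ^+ 2) hN hn => k l w hk hl; lra.
move=> /cvg_ex[p /cvgrPdist_lt up]; exists p => y.
apply: le_trans (mle y); rewrite -/(phi p) leNgt; apply/negP => mp.
pose d := `|z - p|.
(* A real [a] below [g p] also covers the case [g p = +oo]. *)
have [a ag am] : exists2 a, (a%:E < g p)%E & m < a + 2^-1 * d ^+ 2.
  move: mp; rewrite /phi -/d; have := gNy p; case: (g p) => [r| |] // _.
    rewrite -EFinD lte_fin => mp; exists ((m + r - 2^-1 * d ^+ 2) / 2).
      by rewrite lte_fin; lra.
    by lra.
  by move=> _; exists (m + 1 - 2^-1 * d ^+ 2); [exact: ltry|lra].
have [e1 e10 ge1] := lsc_ball _ _ _ lsc ag.
(* The gap [c] will be exceeded by two errors, each below c / 2: d |p - u n| for the quadratic term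
   and 1 / (n + 1) for the near-minimality of [u n]. *)
pose c := a + 2^-1 * d ^+ 2 - m.
have c0 : 0 < c by rewrite /c; lra.
have d0 : 0 <= d by exact: normr_ge0.
have e20 : 0 < c / 2 / (d + 1) by rewrite !divr_gt0// ltr_wpDl.
have c20 : 0 < c / 2 by rewrite divr_gt0.
have [n [[n1 n2] /= n3]] := filter_ex (filterI (filterI (up _ e10) (up _ e20))
  (near_infty_natSinv_lt (PosNum c20))).
have := uP n.
move: (ge1 _ n1); rewrite /phi; case: (g (u n)) => [r| |] //.
rewrite lte_fin -EFinD lee_fin => ar nn.
have zp : d - `|p - u n| <= `|z - u n|.
  rewrite lerBlDr /d; have -> : z - p = (z - u n) - (p - u n) by rewrite opprB addrA subrK.
  exact: ler_normB.
move: n2; rewrite ltr_pdivlMr ?ltr_wpDl// => n2.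
move: (normr_ge0 (z - u n)) (normr_ge0 (p - u n)) zp n2 n3 nn.
move: `|z - u n| `|p - u n| (n.+1%:R^-1) => s w k s0 w0 zp n2 n3 nn.
have sd : d ^+ 2 - 2 * d * w <= s ^+ 2.
  have [dw|dw] := leP d w.
    by have := sqr_ge0 s; have := mulr_ge0 d0 w0; have := ler_wpM2l d0 dw; nra.
  have : (d - w) ^+ 2 <= s ^+ 2 by rewrite ler_pXn2r ?nnegrE//; lra.
  by have := sqr_ge0 w; nra.
have : d * w < c / 2 by have := mulr_ge0 d0 w0; lra.
rewrite /c in n3 *; lra.
Qed.

(** Compare [p] with the points of the segment from [p] to [y]; the second-order term vanishes as
    they approach [p]. *)
Lemma is_prox_vi g z p : (forall y, g y != -oo)%E -> convex_efun g ->
  dom g !=set0 -> is_prox g z p ->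
  dom g p /\ forall y, (g p + (inner (z - p) (y - p))%:E <= g y)%E.
Proof.
move=> gNy cvx [y0 y0dom] pP.
have pdom : dom g p.
  rewrite /dom/= ltey; apply/eqP => gp; have := pP y0.
  move: y0dom; rewrite gp /dom/=; case: (g y0) => [r| |] //.
split=> // y; have := gNy y; have := gNy p; have := pdom; rewrite /dom/=.
case gp : (g p) => [a| |]; case gy : (g y) => [b| |] // _ _ _; last by rewrite leey.
rewrite -EFinD lee_fin -subr_le0.
apply: (@le0_of_quadratic _ (2^-1 * `|y - p| ^+ 2)) => [|t t01].
  by rewrite mulr_ge0// exprn_ge0.
have := cvx y p _ t01; rewrite gp gy -!EFinM -EFinD => mid.
have := le_trans (pP _) (leeD mid (le_refl _)).
rewrite gp -!EFinD lee_fin (sqr_dist z p (t *: y + _)).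
have -> : t *: y + (1 - t) *: p - p = t *: (y - p).
  by rewrite scalerBl scale1r scalerBr -addrA (addrAC p) subrr add0r.
rewrite innerZr normrZ exprMn real_normK ?num_real// => {gp gy} h; lra.
Qed.

(** Expanding |z - y|^2 around [p] leaves a surplus |y - p|^2 / 2, which gives both minimality and
    uniqueness. *)
Lemma vi_prox g z p : dom g p -> (g p != -oo)%E ->
  (forall y, (g p + (inner (z - p) (y - p))%:E <= g y)%E) -> prox g z = p.
Proof.
rewrite /dom/=; case gp : (g p) => [a| |] // _ _ vi; apply: xget_unique.
  move=> y; have := vi y; rewrite gp; move: gp => _.
  case: (g y) => [b|_|//]; last by rewrite [leRHS]addye ?leey.
  rewrite -!EFinD !lee_fin (sqr_dist z p y).
  have := sqr_ge0 `|y - p|; lra.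
move=> q /(_ p); have := vi q; rewrite gp; move: gp => _; case: (g q) => [b| |] //.
rewrite -!EFinD !lee_fin (sqr_dist z p q) => h1 h2.
apply/eqP; rewrite -subr_eq0 -normr_eq0 -sqrf_eq0 eq_le sqr_ge0 andbT; lra.
Qed.

Definition convex_subset C := forall x y t, 0 < t < 1 -> C x -> C y ->
  C (t *: x + (1 - t) *: y).

Lemma vi_metric_proj C z p : C p ->
  (forall y, C y -> inner (z - p) (y - p) <= 0) -> metric_proj C z = p.
Proof.
move=> Cp vi; apply: xget_unique.
  split=> // y Cy; rewrite -(@ler_pXn2r _ 2)// ?nnegrE// (sqr_dist z p y).
  by have := sqr_ge0 `|y - p|; have := vi y Cy; lra.
move=> q [Cq /(_ p Cp)]; rewrite -(@ler_pXn2r _ 2)// ?nnegrE// (sqr_dist z p q).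
move=> h; apply/eqP; rewrite -subr_eq0 -normr_eq0 -sqrf_eq0 eq_le sqr_ge0 andbT.
by have := vi q Cq; lra.
Qed.

(** The indicator function [g] of [C] turns projections into proximal points, so [prox_exists]
    supplies the projection. *)
Lemma metric_proj_vi C z : closed C -> convex_subset C -> C !=set0 ->
  C (metric_proj C z) /\
  forall y, C y -> inner (z - metric_proj C z) (y - metric_proj C z) <= 0.
Proof.
move=> Ccl Ccvx [x0 Cx0].
pose g y : \bar R := (if y \in C then 0 else +oo)%E.
have gE y : C y -> g y = 0%E by move=> Cy; rewrite /g mem_set.
have gNE y : ~ C y -> g y = +oo%E by move=> Cy; rewrite /g memNset.
have g0 y : (0 <= g y)%E by rewrite /g; case: ifP => // _; rewrite leey.
have gNy y : (g y != -oo)%E by rewrite gt_eqF// (lt_le_trans _ (g0 y)).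
have gcvx : convex_efun g.
  move=> x y t t01; have /andP[t0 t1] := t01.
  have [Cx|Cx] := pselect (C x); last first.
    rewrite (gNE _ Cx) gt0_muley ?lte_fin// addye ?leey//.
    by rewrite gt_eqF// (lt_le_trans _ (mule_ge0 _ (g0 y)))// lee_fin; lra.
  have [Cy|Cy] := pselect (C y); last first.
    rewrite (gNE _ Cy) (gE _ Cx) mule0 add0e gt0_muley ?leey// lte_fin; lra.
  by rewrite !gE ?mule0 ?adde0//; exact: Ccvx.
have gdom : dom g !=set0 by exists x0; rewrite /dom/= gE.
have glsc : lower_semicontinuous g.
  move=> x a ax; have [Cx|Cx] := pselect (C x).
    exists setT; first exact: filterT.
    by move=> y _; apply: lt_le_trans (g0 y); rewrite -(gE _ Cx).
  exists (~` C); last by move=> y /gNE ->; rewrite ltry.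
  by apply: open_nbhs_nbhs; split=> //; exact: closed_openC.
have [|p] := prox_exists g z 0 glsc gcvx gdom.
  by move=> y; rewrite adde_ge0// lee_fin mulr_ge0// exprn_ge0.
move=> /(is_prox_vi _ _ _ gNy gcvx gdom)[pdom vi].
have Cp : C p by apply: contrapT => /gNE gp; move: pdom; rewrite /dom/= gp.
have {}vi y : C y -> inner (z - p) (y - p) <= 0.
  by move=> Cy; have := vi y; rewrite !gE// add0e lee_fin.
by rewrite (vi_metric_proj _ _ _ Cp vi).
Qed.

End prox_theory.

(** * Projections onto epigraphs *)

Lemma between_EFin {R : realType} (a : R) (x : \bar R) : (a%:E < x)%E ->
  exists2 b : R, a < b & (b%:E < x)%E.
Proof.
case: x => [r| |] //; last by move=> _; exists (a + 1); [rewrite ltrDl|rewrite ltry].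
rewrite lte_fin => ar; exists ((a + r) / 2); first by rewrite midf_lt.
by rewrite lte_fin midf_lt.
Qed.

(** * Closures, domains and epigraphs of convex functions *)

Section Gamma0_theory.
Context {R : realType} {G : hilbertType R}.
Implicit Types (g : G -> \bar R) (A : set G) (e t : R) (x y z p : G).

Lemma closure_dist A p e : closure A p -> 0 < e -> exists2 y, A y & `|p - y| < e.
Proof.
move=> Ap e0; have [|y [Ay py]] := Ap (ball p e); first exact: nbhsx_ballx.
by exists y => //; move: py; rewrite -ball_normE.
Qed.

Lemma dist_closure A p : (forall e, 0 < e -> exists2 y, A y & `|p - y| < e) ->
  closure A p.
Proof.
move=> h B /nbhs_ballP[e /= e0 pB]; have [y Ay py] := h e e0.
by exists y; split=> //; apply: pB; rewrite -ball_normE.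
Qed.

Lemma closure_convex A : convex_subset A -> convex_subset (closure A).
Proof.
move=> Acvx x y t t01 Ax Ay; apply: dist_closure => e e0.
have [x' Ax' xx'] := closure_dist _ _ _ Ax e0.
have [y' Ay' yy'] := closure_dist _ _ _ Ay e0.
exists (t *: x' + (1 - t) *: y'); first exact: Acvx.
have -> : t *: x + (1 - t) *: y - (t *: x' + (1 - t) *: y') =
    t *: (x - x') + (1 - t) *: (y - y') by rewrite opprD addrACA -!scalerBr.
have /andP[t0 t1] := t01.
apply: le_lt_trans (ler_normD _ _) _; rewrite !normrZ !ger0_norm ?subr_ge0 ?ltW//.
nra.
Qed.

(** If the inner product at [y] were some i > 0, it would stay positive at a point of [A] closer to
    [y] than i / (|z - p| + 1); the + 1 keeps the divisor nonzero. *)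
Lemma closure_vi A z p y : (forall y, A y -> inner (z - p) (y - p) <= 0) ->
  closure A y -> inner (z - p) (y - p) <= 0.
Proof.
move=> vi Ay; rewrite leNgt; apply/negP => i0.
have n0 : 0 < `|z - p| + 1 by rewrite ltr_wpDl.
have [y' /vi i' yy'] := closure_dist _ _ _ Ay (divr_gt0 i0 n0).
have := inner_le_norm (z - p) (y - y').
have -> : y - y' = (y - p) + - (y' - p) by rewrite opprB addrA subrK.
rewrite innerDr innerNr.
have -> : `|y - p - (y' - p)| = `|y - y'| by rewrite opprB addrA subrK.
move: yy'; rewrite ltr_pdivlMr//.
have := normr_ge0 (y - y'); move: (normr_ge0 (z - p)).
by nra.
Qed.

Lemma inner_hsumE (v w : hsum G R^o) :
  inner v w = inner v.1 w.1 + (v.2 : R) * w.2.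
Proof. by []. Qed.

Lemma fst_norm_le (w : hsum G R^o) : `|w.1| <= `|w|.
Proof.
rewrite hsum_normE -[leLHS]normr_id -sqrtr_sqr ler_wsqrtr//.
by rewrite lerDl sqr_ge0.
Qed.

Lemma snd_norm_le (w : hsum G R^o) : `|w.2| <= `|w|.
Proof.
rewrite hsum_normE -[leLHS]normr_id -sqrtr_sqr ler_wsqrtr//.
by rewrite lerDr sqr_ge0.
Qed.

Lemma dom_convex g : convex_efun g -> convex_subset (dom g).
Proof.
move=> cvx x y t t01; rewrite /dom/= => gx gy.
have /andP[t0 t1] := t01.
apply: le_lt_trans (cvx _ _ _ t01) _; apply: lte_add_pinfty.
  by apply: lte_mul_pinfty => //; rewrite ?lee_fin ?ltW.
by apply: lte_mul_pinfty => //; rewrite ?lee_fin ?subr_ge0 ?ltW.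
Qed.

Lemma epi_convex g : convex_efun g -> convex_subset (epi g).
Proof.
move=> cvx v w t t01; rewrite /epi/= => gv gw.
have /andP[t0 t1] := t01.
apply: le_trans (cvx _ _ _ t01) _.
rewrite [leRHS](_ : _ = t%:E * (v.2 : R)%:E + (1 - t)%:E * (w.2 : R)%:E)%E//.
by apply: leeD; apply: lee_wpmul2l => //; rewrite lee_fin ?subr_ge0 ltW.
Qed.

Lemma dom_EFin g x : Gamma0 g -> dom g x -> exists r, g x = r%:E.
Proof.
move=> [[gNy _] _ _]; rewrite /dom/=; have := gNy x.
by case: (g x) => [r| |] // _ _; exists r.
Qed.

End Gamma0_theory.

(** * Variational inequalities for epigraphs and closed domains *)

Section Gamma0_projections.
Context {R : realType} {G : hilbertType R}.
Implicit Types (g : G -> \bar R) (A : set G) (a c d r m : R) (u x y z p : G).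

Lemma epi_closed g : lower_semicontinuous g -> closed (epi g).
Proof.
(* Near [v], the values of [g] stay above [b] while second coordinates stay below it. *)
move=> lsc v Av; rewrite /epi/= leNgt; apply/negP => /between_EFin[b vb bg].
have [e e0 eg] := lsc_ball _ _ _ lsc bg.
have m0 : 0 < Num.min e (b - v.2) by rewrite lt_min e0 subr_gt0.
have [w gw] := closure_dist _ _ _ Av m0; rewrite lt_min => /andP[we wb].
have /eg : `|v.1 - w.1| < e := le_lt_trans (fst_norm_le (v - w)) we.
move=> /lt_le_trans/(_ gw); rewrite lte_fin.
have := le_lt_trans (snd_norm_le (v - w)) wb.
rewrite /= ltr_norml => /andP[h _] h'; move: h h' => /=.
by rewrite ltNge => /negP h h'; apply: h; lra.
Qed.

Lemma epi_projP g z d : Gamma0 g ->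
  let w := metric_proj (epi g) ((z, d) : hsum G R^o) in
  (g w.1 <= (w.2)%:E)%E /\ forall y s, (g y <= s%:E)%E ->
    inner (z - w.1) (y - w.1) + (d - w.2) * (s - w.2) <= 0.
Proof.
move=> gG; have [[gNy [x0 x0dom]] lsc cvx] := gG.
have [r gx0] := dom_EFin _ _ gG x0dom.
have ne : epi g !=set0 by exists (x0, r); rewrite /epi/= gx0.
have [w vi] := metric_proj_vi _ ((z, d) : hsum G R^o) (epi_closed _ lsc) (epi_convex _ cvx) ne.
by split=> // y s ys; exact: vi ((y, s) : hsum G R^o) ys.
Qed.

Lemma vi_epi_proj g z d p r : (g p <= r%:E)%E ->
  (forall y s, (g y <= s%:E)%E ->
    inner (z - p) (y - p) + (d - r) * (s - r) <= 0) ->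
  metric_proj (epi g) ((z, d) : hsum G R^o) = (p, r).
Proof. by move=> gp vi; apply: vi_metric_proj => // -[y s]; exact: vi. Qed.

Lemma closure_dom_projP g z : Gamma0 g ->
  let q := metric_proj (closure (dom g)) z in
  closure (dom g) q /\ forall y, dom g y -> inner (z - q) (y - q) <= 0.
Proof.
move=> [[_ [x0 x0dom]] _ cvx].
have [||q vi] := metric_proj_vi _ z (@closed_closure _ (dom g)).
- exact/closure_convex/dom_convex.
- by exists x0; exact: subset_closure.
- by split=> // y ydom; apply: vi; exact: subset_closure.
Qed.

Lemma vi_closure_proj A z p : closure A p ->
  (forall y, A y -> inner (z - p) (y - p) <= 0) ->
  metric_proj (closure A) z = p.
Proof. by move=> Ap vi; apply: vi_metric_proj => // y; exact: closure_vi. Qed.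

Lemma epi_proj_above g z d : Gamma0 g ->
  (d%:E < g (metric_proj (closure (dom g)) z))%E ->
  exists p r, [/\ metric_proj (epi g) ((z, d) : hsum G R^o) = (p, r), d < r,
    g p = r%:E &
    forall y, (r%:E + (inner (z - p) (y - p) / (r - d))%:E <= g y)%E].
Proof.
move=> gG dq; have [[gNy _] _ _] := gG.
have := epi_projP _ z d gG.
case: (metric_proj (epi g) _) => p r /= [gpr vi].
have pdom : dom g p by apply: le_lt_trans gpr _; rewrite ltry.
have [b gp] := dom_EFin _ _ gG pdom.
have rd : d < r.
  (* Epigraphs are closed upwards: test at [(p, r + 1)]. *)
  have rd : d <= r.
    have := vi p (r + 1); rewrite subrr -(scale0r 0) innerZr mul0r add0r addrAC subrr add0r mulr1.
    by rewrite subr_le0; apply; apply: le_trans gpr _; rewrite lee_fin lerDl.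
  (* If [d = r], the inequality characterizes the projection onto the closed domain, and [g p <= d]
     contradicts [dq]. *)
  rewrite lt_neqAle rd andbT; apply/eqP => dr; move: dq; rewrite ltNge => /negP; apply.
  rewrite (vi_closure_proj _ _ p) ?dr//; first exact: subset_closure.
  move=> y ydom; have [s gy] := dom_EFin _ _ gG ydom.
  by have := vi y s; rewrite gy dr subrr mul0r addr0; exact.
(* Testing at [(p, b)] gives (d - r) (b - r) <= 0, hence r <= b. *)
have br : b = r.
  apply/eqP; rewrite eq_le; move: gpr; rewrite gp lee_fin => ->/=.
  have := vi p b; rewrite gp subrr -(scale0r 0) innerZr mul0r add0r => /(_ (lexx _)).
  by clear gp; nra.
exists p, r; split=> //; first by rewrite gp br.
move=> y; have := gNy y; have := vi y; case: (g y) => [s| |] //; last by rewrite leey.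
move=> /(_ s (lexx _)) h _; rewrite -EFinD lee_fin -lerBrDl ler_pdivrMr ?subr_gt0//.
by clear gp; lra.
Qed.

(** * Affine minorants and Fenchel-Moreau duality *)

(** Equivalently, the Fenchel conjugate of [g] is at most [c] at [u]. *)
Definition affine_minorant g u c := forall y, ((inner u y - c)%:E <= g y)%E.

(** The hyperplane supporting the epigraph at the projection [(p, r)] has slope (z - p) / (r - d);
    its height at [z] is r + |z - p|^2 / (r - d) > d. *)
Lemma epi_proj_minorant g z d : Gamma0 g ->
  (d%:E < g (metric_proj (closure (dom g)) z))%E ->
  exists u c, affine_minorant g u c /\ d < inner u z - c.
Proof.
move=> gG /(epi_proj_above _ _ _ gG)[p [r [_ dr gp vi]]].
exists ((r - d)^-1 *: (z - p)), ((r - d)^-1 * inner (z - p) p - r); split.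
  move=> y; apply: le_trans (vi y); rewrite -EFinD lee_fin innerZl.
  by rewrite innerDr innerNr; clear gp; lra.
rewrite innerZl opprB addrA addrAC -mulrBr.
have -> : inner (z - p) z - inner (z - p) p = `|z - p| ^+ 2.
  by rewrite -innerNr -innerDr innerE.
by rewrite ltr_wpDl// mulr_ge0// ?exprn_ge0// invr_ge0 subr_ge0 ltW.
Qed.

(** Project a point lying one unit below the graph over a point of the domain, which is its own
    projection onto the closed domain. *)
Lemma affine_minorant_exists g : Gamma0 g -> exists u c, affine_minorant g u c.
Proof.
move=> gG; have [[_ [x0 x0dom]] _ _] := gG.
have [r gx0] := dom_EFin _ _ gG x0dom.
have [|u [c [h _]]] := epi_proj_minorant _ x0 (r - 1) gG; last by exists u, c.
rewrite (vi_closure_proj _ _ x0); first by rewrite gx0 lte_fin ltrBlDr ltrDl.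
  exact: subset_closure.
by move=> y _; rewrite subrr -(scale0r 0) innerZl mul0r.
Qed.

(* Fenchel-Moreau.  When the projection [q] of [x] onto the closed domain
   satisfies [g q <= a], the normal direction [x - q] can be added to any
   minorant with an arbitrarily large coefficient. *)
Lemma affine_minorant_above g x a : Gamma0 g -> (a%:E < g x)%E ->
  exists u c, affine_minorant g u c /\ a < inner u x - c.
Proof.
move=> gG ax; have [gqa|] := leP (g (metric_proj (closure (dom g)) x)) a%:E;
  last exact: epi_proj_minorant.
have [] := closure_dom_projP _ x gG.
set q := metric_proj _ _ in gqa * => _ vi.
have xq : 0 < `|x - q| ^+ 2.
  rewrite exprn_gt0// normr_gt0 subr_eq0; apply/eqP => xq.
  by move: gqa; rewrite -xq leNgt ax.
have [u [c uc]] := affine_minorant_exists _ gG.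
(* The added term contributes n |x - q|^2 at [x], more than the missing height, and is nonpositive
   on the domain. *)
pose n := (`|a - (inner u x - c)| + 1) / `|x - q| ^+ 2.
have n0 : 0 <= n by rewrite divr_ge0 ?ltW// ltr_wpDl.
exists (u + n *: (x - q)), (c + n * inner (x - q) q); split.
  move=> y; have [ydom|ydom] := pselect (dom g y); last first.
    by move: ydom; rewrite /dom/= ltey => /negP; rewrite negbK => /eqP ->; rewrite leey.
  apply: le_trans (uc y); rewrite lee_fin innerDl innerZl.
  have := vi y ydom; rewrite innerDr innerNr; nra.
have -> : inner (u + n *: (x - q)) x - (c + n * inner (x - q) q) =
    (inner u x - c) + n * `|x - q| ^+ 2.
  rewrite innerDl innerZl -innerE innerDr innerNr; lra.
rewrite -ltrBlDl /n divfK ?gt_eqF//.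
by apply: le_lt_trans (ler_norm _) _; rewrite ltrDl.
Qed.

(** Converse of Fenchel-Moreau: suprema of affine functions are convex and lower semicontinuous. *)
Lemma Gamma0_of_minorants g : dom g !=set0 ->
  (exists u c, affine_minorant g u c) ->
  (forall x a, (a%:E < g x)%E ->
    exists u c, affine_minorant g u c /\ a < inner u x - c) -> Gamma0 g.
Proof.
move=> gdom [u0 [c0 uc0]] above; split.
- by split=> // x; apply/eqP => gx; have := uc0 x; rewrite gx leeNy_eq.
- move=> x a /above[u [c [uc aux]]].
  have u1 : 0 < `|u| + 1 by rewrite ltr_wpDl.
  (* Within this radius, Cauchy-Schwarz keeps the minorant above [a]. *)
  have e0 : 0 < (inner u x - c - a) / (`|u| + 1) by rewrite divr_gt0// subr_gt0.
  exists (ball x ((inner u x - c - a) / (`|u| + 1))); first exact: nbhsx_ballx.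
  move=> y; rewrite -ball_normE /= ltr_pdivlMr// => xy.
  apply: lt_le_trans (uc y); rewrite lte_fin.
  have := inner_le_norm u (x - y); rewrite innerDr innerNr.
  have := normr_ge0 (x - y); nra.
- move=> x y t t01; have /andP[t0 t1] := t01.
  have gNy z : (g z != -oo)%E by apply/eqP => gz; have := uc0 z; rewrite gz leeNy_eq.
  have s0 : 0 < 1 - t by rewrite subr_gt0.
  move: (gNy x) (gNy y).
  case gx : (g x) => [a| |]; case gy : (g y) => [b| |] // _ _.
  (* An affine minorant is at most [a] and [b] at the endpoints, so it cannot exceed the chord
     between them. *)
  + rewrite leNgt -!EFinM -EFinD; apply/negP => /above[u [c [uc]]].
    have := uc x; have := uc y; rewrite gx gy !lee_fin innerDr !innerZr => h1 h2.
    clear gx gy; nra.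
  + by rewrite gt0_muley ?lte_fin// addey ?leey// -EFinM.
  + by rewrite gt0_muley ?lte_fin// addye ?leey// -EFinM.
  + by rewrite !gt0_muley ?lte_fin// addye ?leey.
Qed.

Lemma Gamma0_scale g m : 0 < m -> Gamma0 g -> Gamma0 (fun x => m%:E * g x)%E.
Proof.
move=> m0 gG; have [[_ [x0 x0dom]] _ _] := gG.
have minor u c : affine_minorant g u c ->
    affine_minorant (fun x => m%:E * g x)%E (m *: u) (m * c).
  move=> uc y; rewrite innerZl -mulrBr EFinM.
  by apply: lee_wpmul2l => //; rewrite lee_fin ltW.
apply: Gamma0_of_minorants.
- by exists x0; rewrite /dom/=; apply: lte_mul_pinfty => //; rewrite lee_fin ltW.
- have [u [c /minor uc]] := affine_minorant_exists _ gG.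
  by exists (m *: u), (m * c).
- move=> x a; rewrite -lte_pdivrMl// -EFinM => /(affine_minorant_above _ _ _ gG).
  move=> [u [c [/minor uc h]]]; exists (m *: u), (m * c); split=> //.
  by rewrite innerZl -mulrBr; move: h; rewrite mulrC ltr_pdivrMr// mulrC.
Qed.

Lemma proxP g z : Gamma0 g -> dom g (prox g z) /\
  forall y, (g (prox g z) + (inner (z - prox g z) (y - prox g z))%:E <= g y)%E.
Proof.
move=> gG; have [[gNy gdom] lsc cvx] := gG.
have [u [c uc]] := affine_minorant_exists _ gG.
(* The bound is the minimum of <u, y> - c + |z - y|^2 / 2, found by completing the square. *)
have [|p pP] := prox_exists g z (inner u z - 2^-1 * `|u| ^+ 2 - c) lsc cvx gdom.
  move=> y; apply: le_trans (leeD (uc y) (lexx _)); rewrite -EFinD lee_fin.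
  have := sqr_ge0 `|u + - (z - y)|.
  by rewrite (sqr_normD u) normrN innerNr innerDr innerNr; lra.
have [pdom vi] := is_prox_vi _ _ _ gNy cvx gdom pP.
by rewrite (vi_prox _ _ _ pdom (gNy p) vi).
Qed.

(** * The two cases of the projection formula *)

Lemma epi_proj_below g z d : Gamma0 g ->
  (g (metric_proj (closure (dom g)) z) <= d%:E)%E ->
  metric_proj (epi g) ((z, d) : hsum G R^o) = (metric_proj (closure (dom g)) z, d).
Proof.
move=> gG gqd; have [_ vi] := closure_dom_projP _ z gG.
apply: vi_epi_proj => // y s ys; rewrite subrr mul0r addr0; apply: vi.
by apply: le_lt_trans ys _; rewrite ltry.
Qed.

(** With r = g p = d + m, the factor d - r is -m, and the inequality of the proximal point becomes
    that of the epigraph. This also drives uniqueness. *)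
Lemma epi_proj_of_prox g z d m : Gamma0 g -> 0 < m ->
  (m%:E + d%:E - g (prox (fun x => m%:E * g x) z) = 0)%E ->
  metric_proj (epi g) ((z, d) : hsum G R^o) =
    (prox (fun x => m%:E * g x)%E z, d + m).
Proof.
move=> gG m0; have [[gNy _] _ _] := gG.
have [pdom] := proxP _ z (Gamma0_scale _ _ m0 gG).
set p := prox _ _ => vi; have := gNy p.
case gp : (g p) => [r| |] // _; rewrite -!EFinD => -[mdr].
apply: vi_epi_proj => [|y s ys]; first by rewrite gp lee_fin; clear gp; lra.
have := le_trans (vi y) (lee_wpmul2l _ ys).
rewrite gp -!EFinM -EFinD !lee_fin => /(_ (ltW m0)).
by clear gp; nra.
Qed.

Lemma epi_proj_prox g z d : Gamma0 g ->
  (d%:E < g (metric_proj (closure (dom g)) z))%E ->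
  exists m, unique (fun m =>
      [/\ 0 < m%:E, m%:E <= - d%:E + g (metric_proj (closure (dom g)) z) &
          m%:E + d%:E - g (prox (fun x => m%:E * g x) z) = 0]%E) m /\
    metric_proj (epi g) ((z, d) : hsum G R^o) =
      (prox (fun x => m%:E * g x)%E z, d + m).
Proof.
move=> gG dq; have [[gNy _] _ _] := gG.
have [p [r [projE dr gp vi]]] := epi_proj_above _ _ _ gG dq.
have [_ qvi] := closure_dom_projP _ z gG.
set q := metric_proj _ z in dq qvi *.
have m0 : 0 < r - d by rewrite subr_gt0.
have proxE : prox (fun x => (r - d)%:E * g x)%E z = p.
  apply: vi_prox; rewrite /dom/= ?gp -?EFinM ?ltry// => y.
  have m0' : (0 <= (r - d)%:E)%E by rewrite lee_fin ltW.
  apply: le_trans (lee_wpmul2l m0' (vi y)).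
  rewrite -!EFinD -!EFinM lee_fin mulrDr [X in _ <= _ + X]mulrC divfK//.
  by rewrite gt_eqF.
exists (r - d); split; last by rewrite proxE addrC subrK.
split.
  split; [by rewrite lte_fin| |by rewrite proxE gp -!EFinD subrK subrr].
  (* The bound amounts to r <= g q: test [vi] at [q], where <z - p, q - p> >= 0 by the projection
     inequality of [q] tested at [p]. *)
  have := gNy q; case gq : (g q) => [b| |] // _; last by rewrite addey// leey.
  rewrite -EFinN -EFinD lee_fin [leRHS]addrC lerD2r.
  have := vi q; rewrite gq -EFinD lee_fin; apply: le_trans; rewrite lerDl.
  rewrite divr_ge0 ?(ltW m0)//.
  have pdom : dom g p by rewrite /dom/= gp ltry.
  have := qvi p pdom.
  have -> : z - p = (z - q) + (q - p) by rewrite addrA subrK.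
  have -> : p - q = - (q - p) by rewrite opprB.
  by rewrite (innerDl (z - q)) innerNr innerE; have := sqr_ge0 `|q - p|; clear gp gq; lra.
(* Every solution yields the same projection, whose last coordinate [d + m'] determines [m']. *)
move=> m' [m'0 _ m'E]; rewrite lte_fin in m'0.
have := epi_proj_of_prox _ _ _ _ gG m'0 m'E; rewrite projE => -[_ ->].
by rewrite addrAC subrr add0r.
Qed.

End Gamma0_projections.

(** * Perspectives *)

Section perspective_theory.
Context {R : realType} {H : hilbertType R}.
Implicit Types (f : H -> \bar R) (u x y : H) (c s t : R).

Definition diff_quotient f x y t := ((t^-1)%:E * (f (x + t *: y)%R - f x))%E.

(** The point x + s y is the convex combination of x + t y and x with weight s / t. *)
Lemma diff_quotient_nondecreasing f x y s t : Gamma0 f -> dom f x ->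
  0 < s <= t -> (diff_quotient f x y s <= diff_quotient f x y t)%E.
Proof.
move=> fG xdom /andP[s0 st]; have [[fNy _] _ cvx] := fG.
have t0 := lt_le_trans s0 st.
have [r fx] := dom_EFin _ _ fG xdom; rewrite /diff_quotient fx.
move: st; rewrite le_eqVlt => /orP[/eqP -> //|st].
have := fNy (x + t *: y); case ft : (f (x + t *: y)) => [b| |] // _; last first.
  by rewrite addye// gt0_muley ?leey// lte_fin invr_gt0.
have l01 : 0 < s / t < 1 by rewrite divr_gt0// ltr_pdivrMr// mul1r st.
have := cvx (x + t *: y) x _ l01.
have -> : (s / t) *: (x + t *: y) + (1 - s / t) *: x = x + s *: y.
  by rewrite scalerDr scalerA divfK ?gt_eqF// addrAC -scalerDl (addrC (s / t)) subrK scale1r.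
rewrite ft fx -!EFinM -EFinD; have := fNy (x + s *: y).
case: (f (x + s *: y)) => [a| |] // _; rewrite lee_fin => h.
rewrite -!EFinD -!EFinM lee_fin ler_pdivrMl//.
have -> : s * (t^-1 * (b - r)) = (s / t) * (b - r) by rewrite mulrA.
by clear ft fx; lra.
Qed.

(** A monotone limit is a supremum, so a single quotient bounds the recession function from
    below. *)
Lemma recession_ereal_sup f y : Gamma0 f ->
  let x := xget 0 (dom f) in
  recession f y = ereal_sup [set diff_quotient f x y t | t in [set t | 0 < t]].
Proof.
move=> fG x; have [[_ fdom] _ _] := fG.
have xdom : dom f x := xgetPex 0 fdom.
(* The value [-oo] for t <= 0 makes [h] monotone on the whole line. *)
pose h t : \bar R := if 0 < t then diff_quotient f x y t else -oo%E.
have hE t : 0 < t -> h t = diff_quotient f x y t by rewrite /h => ->.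
have hmono : {homo h : s t / s <= t >-> (s <= t)%E}.
  move=> s t st; rewrite {1}/h; case: ifPn => s0; last by rewrite leNye.
  by rewrite hE ?(lt_le_trans s0)//; apply: diff_quotient_nondecreasing; rewrite ?s0.
have -> : recession f y = ereal_sup (range h).
  apply: cvg_lim => //; apply: cvg_trans (nondecreasing_cvge hmono).
  by apply: near_eq_cvg; near=> t; rewrite hE.
apply/eqP; rewrite eq_le; apply/andP; split; apply: ub_ereal_sup => _ [t t0 <-].
  rewrite /h; case: ifPn => [t0'|_]; last by rewrite leNye.
  by apply: ereal_sup_ubound; exists t.
by apply: ereal_sup_ubound; exists t => //; rewrite hE.
Unshelve. all: by end_near. Qed.

Lemma recession_minorant f u c y : Gamma0 f -> affine_minorant f u c ->
  ((inner u y)%:E <= recession f y)%E.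
Proof.
move=> fG uc; rewrite (recession_ereal_sup _ _ fG); set x := xget _ _.
have [[fNy fdom] _ _] := fG.
have [r fx] := dom_EFin _ _ fG (xgetPex 0 fdom : dom f x).
apply/lee_addgt0Pr => e e0; rewrite -leeBlDr//.
pose k := r + c - inner u x.
(* The quotient at [t] is at least <u, y> - k / t, and this [t] makes k / t < e. *)
pose t := (`|k| + 1) / e.
have t0 : 0 < t by rewrite divr_gt0// ltr_wpDl.
apply: (@le_trans _ _ (diff_quotient f x y t)); last by apply: ereal_sup_ubound; exists t.
rewrite /diff_quotient fx; have := uc (x + t *: y).
case: (f (x + t *: y)) => [b| |] //; last first.
  by move=> _; rewrite addye// gt0_muley ?leey// lte_fin invr_gt0.
rewrite -!EFinD -!EFinM !lee_fin innerDr innerZr ler_pdivlMl// => h.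
have te : t * e = `|k| + 1 by rewrite divfK ?gt_eqF.
by have := ler_norm k; rewrite mulrBr te /k; clear fx; lra.
Qed.

(** Homogenization turns the constant [c] into the coefficient of the second variable, leaving a
    linear minorant. *)
Lemma perspective_minorant f u c : Gamma0 f -> affine_minorant f u c ->
  affine_minorant (perspective f) ((u, - c) : hsum H R^o) 0.
Proof.
move=> fG uc [y s]; rewrite subr0 inner_hsumE /perspective /=.
case: ifPn => [s0|_].
  have s0' : (0 <= s%:E)%E by rewrite lee_fin ltW.
  apply: le_trans (lee_wpmul2l s0' (uc _)); rewrite -EFinM lee_fin innerZr.
  by rewrite mulrBr mulrA mulfV ?gt_eqF// mul1r mulNr mulrC.
case: ifPn => [/eqP ->|_]; last by rewrite leey.
by rewrite mulr0 addr0; exact: recession_minorant.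
Qed.

(** The homogenized minorants of [f] are shown to have the perspective as supremum, separately for
    each sign of the second variable. *)
Lemma Gamma0_perspective f : Gamma0 f -> Gamma0 (perspective f).
Proof.
move=> fG; have [[fNy [x xdom]] _ _] := fG.
have [u0 [c0 uc0]] := affine_minorant_exists _ fG.
apply: Gamma0_of_minorants.
- exists ((x, 1) : hsum H R^o).
  by rewrite /dom/= /perspective/= ltr01 invr1 scale1r mul1e.
- by exists ((u0, - c0) : hsum H R^o), 0; exact: perspective_minorant.
- move=> [y s] a; rewrite /perspective /=; case: ifPn => [s0|s0].
    rewrite -lte_pdivrMl// -EFinM => /(affine_minorant_above _ _ _ fG)[u [c [uc]]].
    rewrite innerZr ltr_pdivrMl// => h.
    exists ((u, - c) : hsum H R^o), 0; split; first exact: perspective_minorant.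
    rewrite subr0 inner_hsumE /=; move: h.
    by rewrite mulrBr mulrA mulfV ?gt_eqF// mul1r mulNr (mulrC s).
  case: ifPn => [/eqP ->|sN0 _].
    rewrite (recession_ereal_sup _ _ fG); set x0 := xget _ _.
    (* Some quotient exceeds [a], so f (x0 + t y) > r + t a. A minorant exceeding r + t a there is
       at most r at [x0], so <u, y> > a. *)
    move=> /ereal_sup_gt[_ [t t0 <-]].
    have [r fx] : exists r, f x0 = r%:E.
      by apply: (dom_EFin _ _ fG); apply: xgetPex; exists x.
    rewrite /diff_quotient fx => h.
    have {h} : ((r + t * a)%:E < f (x0 + t *: y)%R)%E.
      move: (fNy (x0 + t *: y)) h; case: (f _) => [b _|_ _|//]; last by rewrite ltry.
      rewrite -EFinD -EFinM !lte_fin ltr_pdivlMl//; clear fx; lra.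
    move=> /(affine_minorant_above _ _ _ fG)[u [c [uc]]].
    rewrite innerDr innerZr => h.
    exists ((u, - c) : hsum H R^o), 0; split; first exact: perspective_minorant.
    rewrite subr0 inner_hsumE /= mulr0 addr0.
    have := uc x0; rewrite fx lee_fin => h'.
    rewrite -(ltr_pM2l t0); clear fx; lra.
  (* Any larger [c] still gives a minorant of [f], and [s < 0]. *)
  have {sN0}s0 : s < 0 by rewrite lt_neqAle sN0 leNgt.
  pose n := (`|a - (inner u0 y - c0 * s)| + 1) / - s.
  have n0 : 0 <= n by rewrite divr_ge0 ?oppr_ge0 ?ltW// ltr_wpDl.
  exists ((u0, - (c0 + n)) : hsum H R^o), 0; split.
    apply: perspective_minorant => // z; apply: le_trans (uc0 z).
    by rewrite lee_fin lerB// lerDl.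
  have ns : n * - s = `|a - (inner u0 y - c0 * s)| + 1.
    by rewrite divfK// oppr_eq0 lt_eqF.
  rewrite subr0 inner_hsumE /=.
  by have := ler_norm (a - (inner u0 y - c0 * s)); lra.
Qed.

End perspective_theory.

Local Open Scope ereal_scope.

(** Both cases hold for every function in [Gamma0] on a Hilbert space, in particular for the
    perspective on the direct sum. *)
Theorem theorem3p1 (R : realType) (H : hilbertType R) (f : H -> \bar R)
    (x : H) (eta delta : R) :
  Gamma0 f ->
  let pf : hsum H R^o -> \bar R := perspective f in
  let xeta : hsum H R^o := (x, eta) in
  let q : hsum H R^o := metric_proj (closure (dom pf)) xeta in
  (pf q <= delta%:E ->
     metric_proj (epi pf) ((xeta, delta) : hsum (hsum H R^o) R^o) = (q, delta)) /\
  (delta%:E < pf q ->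
     exists mu : R,
       unique (fun m : R =>
           [/\ 0 < m%:E, m%:E <= - delta%:E + pf q &
               m%:E + delta%:E - pf (prox (fun z => m%:E * pf z) xeta) = 0])
         mu /\
       metric_proj (epi pf) ((xeta, delta) : hsum (hsum H R^o) R^o) =
         (prox (fun z => mu%:E * pf z) xeta, (delta + mu)%R)).
Proof.
move=> /Gamma0_perspective pfG pf xeta q.
by split; [exact: epi_proj_below|exact: epi_proj_prox].
Qed.
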